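(* Let $\mu$ be a finite Borel measure on $\mathbb{R}$ that is continuous (has no atoms), and let $x\in\mathrm{supp}\,\mu$. Let $m>\varsigma\ge0$ be real numbers and assume that $$\liminf_{\epsilon\to0+}\epsilon^{-\varsigma}J_{\mu,m}(x,\epsilon)>0.$$ Then $$\gamma_\mu^+(x)\le\frac{\varsigma\,(m-\gamma_\mu^-(x))}{m-\varsigma}.$$ In particular, $$\gamma_\mu^+(x)\le\frac{m\varsigma}{m-\varsigma}.$$
   Context: For $m>0$, $x\in\mathbb{R}$, $\epsilon>0$, the $m$-Borel transform of $\mu$ is $J_{\mu,m}(x,\epsilon)=\epsilon^m\int_{\mathbb{R}}\frac{d\mu(y)}{|x-y|^m+\epsilon^m}$. For $x\in\mathrm{supp}\,\mu$, the local exponents are $\gamma_\mu^-(x)=\liminf_{\epsilon\to0+}\frac{\log\mu([x-\epsilon,x+\epsilon])}{\log\epsilon}$ and $\gamma_\mu^+(x)=\limsup_{\epsilon\to0+}\frac{\log\mu([x-\epsilon,x+\epsilon])}{\log\epsilon}$. *)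

(* Defs.v *)
From mathcomp Require Import all_boot all_order all_algebra.
From mathcomp Require Import all_classical all_reals all_analysis.
Import Order.TTheory GRing.Theory Num.Theory.
Import numFieldNormedType.Exports.

Set Implicit Arguments.
Unset Strict Implicit.
Unset Printing Implicit Defensive.

Local Open Scope classical_set_scope.
Local Open Scope ring_scope.

Definition atomless (R : realType)
    (mu : {finite_measure set (measurableTypeR R) -> \bar R}) : Prop :=
  forall y : R, mu [set y] = 0%E.

Definition msupport (R : realType)
    (mu : {finite_measure set (measurableTypeR R) -> \bar R}) : set R :=
  [set x | forall U : set R, open U -> U x -> (0 < mu U)%E].

Definition borel_transform (R : realType)
    (mu : {finite_measure set (measurableTypeR R) -> \bar R})
    (m x eps : R) : \bar R :=
  ((eps `^ m)%:E * \int[mu]_y ((`|x - y| `^ m + eps `^ m)^-1)%:E)%E.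

Definition log_ratio (R : realType)
    (mu : {finite_measure set (measurableTypeR R) -> \bar R})
    (x eps : R) : \bar R :=
  (lne (mu `[(x - eps)%R, (x + eps)%R]%classic) * ((ln eps)^-1)%:E)%E.

Definition lower_exponent (R : realType)
    (mu : {finite_measure set (measurableTypeR R) -> \bar R}) (x : R) : \bar R :=
  limf_einf (log_ratio mu x) 0^'+.

Definition upper_exponent (R : realType)
    (mu : {finite_measure set (measurableTypeR R) -> \bar R}) (x : R) : \bar R :=
  limf_esup (log_ratio mu x) 0^'+.

(* Main.v *)
(** Put f(r) = mu [x - r, x + r] and let g(a) be the integral of
    1 / (|x - y|^m + a^m), so that J(x, a) = a^m g(a).  Splitting the integral
    at |x - y| = r gives g(a) <= a^(-m) f(r) + 2 g(r) for all a, r > 0.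
    If gamma < m and f(r) <= r^gamma near 0 (true for gamma < gamma^-), this
    inequality between the scales r and L r, for L large, shows by induction
    that g(r) <= C r^(gamma - m).  Inserting this and c a^s <= J(x, a) in the
    splitting inequality, with a proportional to r^((m - gamma) / (m - s)) so
    that the g-term absorbs only half of c a^s, yields
    f(r) >= c' r^(s (m - gamma) / (m - s)), i.e.
    gamma^+ <= s (m - gamma) / (m - s); then gamma tends to gamma^-. *)
Require Import Defs.
From mathcomp Require Import all_boot all_order all_algebra.
From mathcomp Require Import all_classical all_reals all_analysis.
From mathcomp Require Import measurable_realfun ring lra.
Import Order.TTheory GRing.Theory Num.Theory.
Import numFieldNormedType.Exports.
Local Open Scope classical_set_scope.
Local Open Scope ring_scope.

(** * Real-variable core: from the splitting inequality to a power lower bound *)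

Lemma powRD_gt0 {R : realType} (r a b : R) : 0 < r ->
  r `^ (a + b) = r `^ a * r `^ b.
Proof. by move=> r0; rewrite powRD// (gt_eqF r0) implybT. Qed.

(** The crude bound with [M] settles the scales within a factor [L] of [delta]. Each further descent
    by [L] costs at most [r ^ (gam - m)] times [L ^ gam + C / 2], which stays below [C] once [C] is
    at least [2 * L ^ gam]. *)
Lemma scale_induction (R : realType) (g f : R -> R) (m gam delta M : R) :
    gam < m -> 0 < m -> 0 < delta -> 0 <= M ->
    (forall a r, 0 < a -> 0 < r -> g a <= a `^ (- m) * f r + 2 * g r) ->
    (forall r, 0 < r -> g r <= r `^ (- m) * M) ->
    (forall r, 0 < r <= delta -> f r <= r `^ gam) ->
  exists2 C, 0 < C & forall r, 0 < r <= delta -> g r <= C * r `^ (gam - m).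
Proof.
move=> gm m0 d0 M0 gsplit gM fgam.
(* L^(m - gam) >= 4 makes the passage from scale L r to r contracting. *)
set L := 2 * 4 `^ (m - gam)^-1.
have mg0 : 0 < m - gam by rewrite subr_gt0.
have L2 : 2 <= L.
  rewrite /L ler_peMr// -[leLHS](powRr0 4) ler_powR ?invr_ge0 ?ltW//; lra.
have L0 : 0 < L by lra.
have Lmg : 2 * L `^ (gam - m) <= 2^-1.
  have -> : gam - m = - (m - gam) by ring.
  rewrite powRN /L powRM ?powR_ge0// -powRrM mulVf ?gt_eqF// powRr1//.
  have : 1 <= (2 : R) `^ (m - gam).
    by rewrite -[leLHS](powRr0 2) ler_powR ?ltW//; lra.
  set t := 2 `^ _ => t1.
  rewrite ler_pdivrMr; lra.
clearbody L.
(* [B] is what the crude bound gives on the top range of scales, from [delta / L] to [delta], after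
   division by [r ^ (gam - m)]. *)
pose B := M * (delta / L) `^ (- m) * delta `^ (m - gam).
have B0 : 0 <= B by rewrite !mulr_ge0// powR_ge0.
pose C := 2 * L `^ gam + B.
have LG0 : 0 < L `^ gam by rewrite powR_gt0.
have C0 : 0 < C by rewrite /C; lra.
exists C => //.
have base r : 0 < r <= delta -> delta <= L * r -> g r <= C * r `^ (gam - m).
  move=> /andP[r0 rd] dr; apply: (le_trans (gM _ r0)).
  have p0 : 0 < r `^ (gam - m) by rewrite powR_gt0.
  apply: (@le_trans _ _ (B * r `^ (gam - m))); last first.
    by rewrite ler_pM2r// /C; lra.
  have dL : delta / L <= r by rewrite ler_pdivrMr// mulrC.
  have h1 : r `^ (- m) <= (delta / L) `^ (- m).
    rewrite !powRN lef_pV2 ?posrE ?powR_gt0 ?divr_gt0//.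
    by rewrite ge0_ler_powR ?nnegrE// ?(ltW m0) ?(ltW r0) ?divr_ge0 ?ltW.
  have h2 : 1 <= delta `^ (m - gam) * r `^ (gam - m).
    rewrite -[gam - m]opprB powRN ler_pdivlMr ?powR_gt0// mul1r.
    by rewrite ge0_ler_powR ?nnegrE// ?(ltW mg0) ?(ltW r0) ?(ltW d0).
  rewrite mulrC /B -!mulrA ler_wpM2l//; apply: (le_trans h1).
  by rewrite ler_peMr ?powR_ge0.
(* Induction on the number [n] of factors [L] that lift [r] to [delta] or beyond. *)
have step n r : 0 < r <= delta -> delta <= L ^+ n * r ->
    g r <= C * r `^ (gam - m).
  elim: n r => [|n IH] r /andP[r0 rd].
    rewrite expr0 mul1r => dr; apply: base; first by rewrite r0 rd.
    by apply: (le_trans dr); rewrite ler_peMl; lra.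
  move=> dr; case: (leP delta (L * r)) => [|Lrd].
    by apply: base; rewrite r0 rd.
  have Lr0 : 0 < L * r by rewrite mulr_gt0.
  (* Kernel scale [r], cut radius [L * r]: the remaining g-term is one scale higher, where [IH]
     applies. *)
  have := gsplit _ _ r0 Lr0.
  have := IH (L * r); rewrite Lr0 (ltW Lrd) mulrA -exprSr => /(_ erefl dr).
  have := fgam (L * r); rewrite Lr0 (ltW Lrd) => /(_ erefl).
  rewrite !powRM ?(ltW L0) ?(ltW r0)// => hf hg hs; apply: (le_trans hs).
  have p0 : 0 < r `^ (- m) by rewrite powR_gt0.
  move: hf; rewrite -(ler_pM2l p0) => hf.
  apply: (le_trans (lerD hf (ler_wpM2l _ hg))) => //.
  rewrite (powRD_gt0 _ gam (- m) r0).
  have pg0 : 0 < r `^ gam by rewrite powR_gt0.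
  have := mulr_gt0 pg0 p0.
  set q := _ * _ => qgt0.
  have -> : r `^ (- m) * (L `^ gam * r `^ gam) = q * L `^ gam.
    by rewrite /q; ring.
  set u := L `^ gam in LG0 C0 *; set v := L `^ _ in Lmg *.
  have -> : q * u + 2 * (C * (v * q)) = q * (u + C * (2 * v)) by ring.
  rewrite mulrC ler_pM2r//.
  have CE : C = 2 * u + B by [].
  have := ler_wpM2l (ltW C0) Lmg; clearbody C; lra.
move=> r /andP[r0 rd].
pose n := Num.Def.archi_bound (delta / r).
apply: (step n); first by rewrite r0.
rewrite -ler_pdivrMr//; apply: (@le_trans _ _ (2 ^+ n)).
  by rewrite ltW// upper_nthrootP.
by rewrite lerXn2r// ?nnegrE; lra.
Qed.

Lemma lower_power_bound (R : realType) (g f : R -> R) (m gam s delta c C : R) :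
    gam < m -> s < m -> 0 < delta -> 0 < c -> 0 < C ->
    (forall a r, 0 < a -> 0 < r -> g a <= a `^ (- m) * f r + 2 * g r) ->
    (forall r, 0 < r <= delta -> g r <= C * r `^ (gam - m)) ->
    (forall a, 0 < a <= delta -> c * a `^ s <= a `^ m * g a) ->
  exists2 c', 0 < c' & exists2 eta, 0 < eta &
    forall r, 0 < r <= eta -> c' * r `^ (s * (m - gam) / (m - s)) <= f r.
Proof.
move=> gm sm d0 c0 C0 gsplit gC glow.
have mg0 : 0 < m - gam by rewrite subr_gt0.
have ms0 : 0 < m - s by rewrite subr_gt0.
(* With [a ^ (m - s) = k * r ^ (m - gam)], the g-term [a ^ m * 2 * g r] is at most
   [2 * k * C * a ^ s]; this [k] makes it [c / 2 * a ^ s]. *)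
pose k := c / (4 * C).
have k0 : 0 < k by rewrite divr_gt0// mulr_gt0//; lra.
exists (c / 2 * k `^ (s / (m - s))).
  by rewrite mulr_gt0 ?powR_gt0//; lra.
(* The radius at which the scale [a] chosen below reaches [delta]. *)
pose eta1 := (delta `^ (m - s) / k) `^ (m - gam)^-1.
have eta10 : 0 < eta1 by rewrite powR_gt0// divr_gt0// powR_gt0.
exists (Num.min delta eta1); first by rewrite lt_min d0.
move=> r /andP[r0]; rewrite le_min => /andP[rd reta].
pose a := (k * r `^ (m - gam)) `^ (m - s)^-1.
have kr0 : 0 < k * r `^ (m - gam) by rewrite mulr_gt0// powR_gt0.
have a0 : 0 < a by rewrite powR_gt0.
have aE : a `^ (m - s) = k * r `^ (m - gam).
  by rewrite -powRrM mulVf ?gt_eqF// powRr1 ?ltW.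
have ad : a <= delta.
  have -> : delta = (delta `^ (m - s)) `^ (m - s)^-1.
    by rewrite -powRrM mulfV ?gt_eqF// powRr1 ?ltW.
  rewrite ge0_ler_powR ?nnegrE ?powR_ge0 ?invr_ge0 ?(ltW ms0) ?(ltW kr0)//.
  rewrite mulrC -ler_pdivlMr//.
  have -> : delta `^ (m - s) / k = eta1 `^ (m - gam).
    by rewrite -powRrM mulVf ?gt_eqF// powRr1// divr_ge0 ?powR_ge0 ?ltW.
  by rewrite ge0_ler_powR ?nnegrE// ltW.
have := glow a; rewrite a0 ad => /(_ erefl) hlow.
have := gC r; rewrite r0 rd => /(_ erefl) hC.
have am0 : 0 < a `^ m by rewrite powR_gt0.
have hs := ler_wpM2l (ltW am0) (gsplit a r a0 r0).
have {}hlow := le_trans hlow hs.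
have aV : a `^ m * a `^ (- m) = 1 by rewrite powRN mulfV// gt_eqF.
have amE : a `^ m = a `^ s * (k * r `^ (m - gam)).
  by rewrite -aE -powRD_gt0// addrC subrK.
have rV : r `^ (m - gam) * r `^ (gam - m) = 1.
  by rewrite -opprB powRN mulVf// gt_eqF// powR_gt0.
have hC2 : a `^ m * (2 * g r) <= c / 2 * a `^ s.
  apply: (@le_trans _ _ (a `^ m * (2 * (C * r `^ (gam - m))))).
    by rewrite ler_wpM2l ?(ltW am0)//; lra.
  rewrite amE.
  have -> : a `^ s * (k * r `^ (m - gam)) * (2 * (C * r `^ (gam - m))) =
     a `^ s * (2 * (k * C)) * (r `^ (m - gam) * r `^ (gam - m)) by ring.
  have kC : k * C = c / 4 by rewrite /k; field; rewrite gt_eqF.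
  rewrite rV kC; lra.
have fE : f r >= c / 2 * a `^ s.
  move: hlow; rewrite mulrDr mulrA aV mul1r; lra.
apply: le_trans fE.
have -> : a `^ s = k `^ (s / (m - s)) * r `^ (s * (m - gam) / (m - s)).
  rewrite /a -powRrM powRM ?powR_ge0 ?(ltW k0)// -powRrM.
  by congr (k `^ _ * r `^ _); field; rewrite gt_eqF.
by rewrite mulrA.
Qed.

(** * Neighbourhoods of 0+ and lower and upper limits along a filter *)

Lemma near_at_right0P (R : realType) (P : set R) :
  (\forall r \near 0^'+, P r) <->
  exists2 d : R, 0 < d & forall r, 0 < r <= d -> P r.
Proof.
split=> [|[d d0 dP]].
  move=> /nbhs_ballP[d /= d0 dP]; exists (d / 2); first by rewrite divr_gt0.
  move=> r /andP[r0 rd]; apply: dP => //=.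
  rewrite /ball /= sub0r normrN gtr0_norm//; lra.
near=> r; apply: dP; apply/andP; split; near: r.
- exact: nbhs_right_gt.
- exact: nbhs_right_le.
Unshelve. all: by end_near. Qed.

Lemma limf_esup_le_near (T : choiceType) (X : filteredType T) (R : realType)
    (f : X -> \bar R) (F : set (set X)) (l : \bar R) :
  F [set t | (f t <= l)%E] -> (limf_esup f F <= l)%E.
Proof.
move=> Fl; rewrite limf_esupE; apply: ge_ereal_inf.
exists (ereal_sup (f @` [set t | (f t <= l)%E])).
  by exists [set t | (f t <= l)%E].
by apply: ge_ereal_sup => _ [t /= ? <-].
Qed.

Lemma limf_einf_ge_near (T : choiceType) (X : filteredType T) (R : realType)
    (f : X -> \bar R) (F : set (set X)) (l : \bar R) :
  F [set t | (l <= f t)%E] -> (l <= limf_einf f F)%E.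
Proof.
move=> Fl; rewrite limf_einfE; apply: le_ereal_sup_tmp.
exists (ereal_inf (f @` [set t | (l <= f t)%E])).
  by exists [set t | (l <= f t)%E].
by apply: le_ereal_inf_tmp => _ [t /= ? <-].
Qed.

Lemma lt_limf_einf_near (T : choiceType) (X : filteredType T) (R : realType)
    (f : X -> \bar R) (F : set (set X)) (l : \bar R) : Filter F ->
  (l < limf_einf f F)%E -> F [set t | (l < f t)%E].
Proof.
move=> FF; rewrite limf_einfE => /ereal_sup_gt[_ [V FV <-]] lV.
apply: filterS FV => t Vt /=; apply: (lt_le_trans lV).
by apply: ge_ereal_inf; exists (f t) => //; exists t.
Qed.

(** Two members of a proper filter share a point, and the value of [f] there separates the infimum
    over one from the supremum over the other. *)
Lemma limf_einf_le_esup (T : choiceType) (X : filteredType T) (R : realType)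
    (f : X -> \bar R) (F : set (set X)) : ProperFilter F ->
  (limf_einf f F <= limf_esup f F)%E.
Proof.
move=> FF; rewrite limf_einfE limf_esupE.
apply: ge_ereal_sup => _ [V FV <-]; apply: le_ereal_inf_tmp => _ [W FW <-].
have [t [Vt Wt]] := filter_ex (filterI FV FW).
apply: (@le_trans _ _ (f t)).
  by apply: ge_ereal_inf; exists (f t) => //; exists t.
by apply: le_ereal_sup_tmp; exists (f t) => //; exists t.
Qed.

(** * The kernel of the Borel transform and its integral *)

Lemma measurable_kernel (R : realType) (x m a : R) :
  measurable_fun setT
    ((fun y => (`|x - y| `^ m + a `^ m)^-1) : measurableTypeR R -> R).
Proof.
have -> : (fun y => (`|x - y| `^ m + a `^ m)^-1) =
          (fun y => (`|x - y| `^ m + a `^ m) `^ (-1)).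
  by apply/funext => y; rewrite powR_inv1// addr_ge0 ?powR_ge0.
apply: (measurableT_comp (measurable_powR _)).
apply: measurable_funD => //.
apply: (measurableT_comp (measurable_powR _)).
apply: (measurableT_comp (@normr_measurable _ _)).
exact: measurable_funB.
Qed.

Lemma kernel_ge0 (R : realType) (x m a y : R) :
  0 <= (`|x - y| `^ m + a `^ m)^-1.
Proof. by rewrite invr_ge0 addr_ge0 ?powR_ge0. Qed.

Lemma kernel_le (R : realType) (x m a y : R) :
  0 < a -> (`|x - y| `^ m + a `^ m)^-1 <= a `^ (- m).
Proof.
move=> a0; rewrite powRN lef_pV2 ?posrE ?ltr_wpDl ?powR_ge0 ?powR_gt0//.
by rewrite lerDr powR_ge0.
Qed.

Lemma kernel_integral_le (R : realType)
    (mu : {finite_measure set (measurableTypeR R) -> \bar R}) (x m a : R) :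
  0 < a ->
  (\int[mu]_y ((`|x - y| `^ m + a `^ m)^-1)%:E <= (a `^ (- m))%:E * mu setT)%E.
Proof.
move=> a0; rewrite -integral_cst//; apply: ge0_le_integral => //.
- by move=> y _; rewrite lee_fin kernel_ge0.
- apply/measurable_EFinP; exact: measurable_kernel.
- by move=> y _; rewrite lee_fin kernel_le.
Qed.

(** Pointwise comparison: on the ball the kernel is at most [a ^ (- m)]; off it [r < |x - y|], so
    the kernel at scale [a] is at most twice the kernel at scale [r]. *)
Lemma kernel_integral_split (R : realType)
    (mu : {finite_measure set (measurableTypeR R) -> \bar R}) (x m a r : R) :
  0 < m -> 0 < a -> 0 < r ->
  (\int[mu]_y ((`|x - y| `^ m + a `^ m)^-1)%:E <=
   (a `^ (- m))%:E * mu `[(x - r)%R, (x + r)%R]%classic +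
   2%:E * \int[mu]_y ((`|x - y| `^ m + r `^ m)^-1)%:E)%E.
Proof.
move=> m0 a0 r0.
have mI : measurable (`[x - r, x + r]%classic : set (measurableTypeR R)).
  exact: measurable_itv.
have mind : measurable_fun setT
    (\1_(`[(x - r)%R, (x + r)%R]%classic : set (measurableTypeR R)) :
      measurableTypeR R -> R).
  exact: measurable_indic.
(* The mass becomes the integral of an indicator, so that the right-hand side merges into one
   integral. *)
have <- : (\int[mu]_y
    ((\1_(`[x - r, x + r]%classic : set (measurableTypeR R)) y : R)%:E) =
    mu `[(x - r)%R, (x + r)%R]%classic)%E by rewrite integral_indic// setIT.
rewrite -ge0_integralZl_EFin ?powR_ge0//; last exact/measurable_EFinP.
rewrite -ge0_integralZl_EFin//; first last.
- by apply/measurable_EFinP; exact: measurable_kernel.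
- by move=> y _; rewrite lee_fin kernel_ge0.
rewrite -ge0_integralD//; first last.
- apply: measurable_funeM; apply/measurable_EFinP; exact: measurable_kernel.
- by move=> y _; rewrite -EFinM lee_fin mulr_ge0// kernel_ge0.
- by apply: measurable_funeM; apply/measurable_EFinP.
- by move=> y _; rewrite -EFinM lee_fin mulr_ge0// powR_ge0.
apply: ge0_le_integral => //.
- by move=> y _; rewrite lee_fin kernel_ge0.
- apply/measurable_EFinP; exact: measurable_kernel.
- apply: emeasurable_funD; apply: measurable_funeM; apply/measurable_EFinP => //.
  exact: measurable_kernel.
move=> y _; rewrite -!EFinM -EFinD lee_fin indicE.
have [yI|yI] := boolP (y \in _).
  rewrite mulr1 (le_trans (kernel_le _ _ _ _ _ a0))//.
  by rewrite lerDl mulr_ge0// kernel_ge0.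
rewrite mulr0 add0r.
have rxy : r < `|x - y|.
  rewrite ltNge; apply: contra yI => yr; rewrite inE/= in_itv/=.
  by move: yr; rewrite ler_norml; lra.
have rm : r `^ m <= `|x - y| `^ m.
  by rewrite ge0_ler_powR ?nnegrE ?(ltW m0) ?(ltW r0) ?(ltW rxy).
have am := @powR_gt0 _ a m a0; have rm0 := @powR_gt0 _ r m r0.
(* After inversion: half of [|x - y| ^ m + r ^ m] is at most [|x - y| ^ m]. *)
rewrite -[2]invrK -invfM lef_pV2 ?posrE; lra.
Qed.

Lemma kernel_integral_fineK (R : realType)
    (mu : {finite_measure set (measurableTypeR R) -> \bar R}) (x m a : R) :
  0 < a ->
  ((fine (\int[mu]_y ((`|x - y| `^ m + a `^ m)^-1)%:E))%:E =
   \int[mu]_y ((`|x - y| `^ m + a `^ m)^-1)%:E)%E.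
Proof.
move=> a0; rewrite fineK// ge0_fin_numE; last first.
  by apply: integral_ge0 => y _; rewrite lee_fin kernel_ge0.
apply: (le_lt_trans (kernel_integral_le _ mu x m _ a0)).
rewrite lte_mul_pinfty ?lee_fin ?powR_ge0//.
by rewrite fin_num_fun_lty// fin_num_measure.
Qed.

(** * Ball masses and the local exponents *)

Lemma ball_mass_gt0 (R : realType)
    (mu : {finite_measure set (measurableTypeR R) -> \bar R}) (x r : R) :
  msupport mu x -> 0 < r -> (0 < mu `[(x - r)%R, (x + r)%R]%classic)%E.
Proof.
move=> xS r0; apply: (@lt_le_trans _ _ (mu `](x - r)%R, (x + r)%R[%classic)).
  apply: xS; first exact: interval_open.
  by rewrite /= in_itv/=; lra.
apply: le_measure; rewrite ?inE; [exact: measurable_itv..|].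
exact: subset_itv_oo_cc.
Qed.

Lemma log_ratioE (R : realType)
    (mu : {finite_measure set (measurableTypeR R) -> \bar R}) (x r : R) :
  msupport mu x -> 0 < r ->
  log_ratio mu x r =
  (ln (fine (mu `[(x - r)%R, (x + r)%R]%classic)) / ln r)%:E.
Proof.
move=> xS r0; have f0 := ball_mass_gt0 _ mu _ _ xS r0.
have fE : (fine (mu `[(x - r)%R, (x + r)%R]%classic))%:E =
          mu `[(x - r)%R, (x + r)%R]%classic.
  by rewrite fineK// fin_num_measure//; exact: measurable_itv.
by rewrite /log_ratio -{1}fE lne_EFin// -lte_fin fE.
Qed.

(** Ball masses never exceed the total mass [M], and [ln M / ln r] tends to 0. *)
Lemma lower_exponent_ge0 (R : realType)
    (mu : {finite_measure set (measurableTypeR R) -> \bar R}) (x : R) :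
  msupport mu x -> (0 <= lower_exponent mu x)%E.
Proof.
move=> xS; apply/lee_addgt0Pr => e e0; rewrite -leeBlDr// add0e.
apply: limf_einf_ge_near; apply/near_at_right0P.
pose M := fine (mu setT).
(* The bound 1/2 keeps [ln r] negative; the other one gives [ln M <= - e * ln r]. *)
exists (Num.min 2^-1 (expR (- ln M / e))).
  by rewrite lt_min expR_gt0 invr_gt0 ltr0n.
move=> r /andP[r0]; rewrite le_min => /andP[r2 rM] /=.
rewrite log_ratioE// lee_fin.
have lnr : ln r < 0 by rewrite ln_lt0// r0/=; lra.
rewrite ler_ndivlMr//.
have f0 := ball_mass_gt0 _ mu _ _ xS r0.
have fT : (mu `[(x - r)%R, (x + r)%R]%classic <= mu setT)%E.
  by apply: le_measure; rewrite ?inE//; exact: measurable_itv.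
have fin1 : mu `[(x - r)%R, (x + r)%R]%classic \is a fin_num.
  by rewrite fin_num_measure//; exact: measurable_itv.
have fin2 : mu setT \is a fin_num by rewrite fin_num_measure.
have fpos : 0 < fine (mu `[(x - r)%R, (x + r)%R]%classic).
  by rewrite -lte_fin fineK.
have fM : fine (mu `[(x - r)%R, (x + r)%R]%classic) <= M by rewrite fine_le.
have Mpos := lt_le_trans fpos fM.
apply: (@le_trans _ _ (ln M)); first by rewrite ler_ln ?posrE.
have : ln r <= - ln M / e by rewrite -[leRHS]expRK ler_ln ?posrE ?expR_gt0.
rewrite ler_pdivlMr//; lra.
Qed.

(** Division by the negative [ln r] reverses the mass bound, and the constant contributes only
    [ln c / ln r], which tends to 0. *)
Lemma upper_exponent_le (R : realType)
    (mu : {finite_measure set (measurableTypeR R) -> \bar R})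
    (x beta c eta : R) :
    msupport mu x -> 0 < c -> 0 < eta ->
    (forall r, 0 < r <= eta ->
      c * r `^ beta <= fine (mu `[(x - r)%R, (x + r)%R]%classic)) ->
  (upper_exponent mu x <= beta%:E)%E.
Proof.
move=> xS c0 eta0 cf; apply/lee_addgt0Pr => e e0; rewrite -EFinD.
apply: limf_esup_le_near; apply/near_at_right0P.
(* The last bound gives [e * ln r <= ln c], so [c] costs at most [e] in the exponent. *)
exists (Num.min eta (Num.min 2^-1 (expR (ln c / e)))).
  by rewrite !lt_min eta0 expR_gt0 invr_gt0 ltr0n.
move=> r /andP[r0]; rewrite !le_min => /and3P[reta r2 rc] /=.
rewrite log_ratioE// lee_fin.
have lnr : ln r < 0 by rewrite ln_lt0// r0/=; lra.
rewrite ler_ndivrMr//.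
have := cf r; rewrite r0 reta => /(_ erefl) cfr.
have rb := @powR_gt0 _ r beta r0.
have cr0 : 0 < c * r `^ beta by rewrite mulr_gt0.
apply: (@le_trans _ _ (ln (c * r `^ beta))); last first.
  by rewrite ler_ln ?posrE// (lt_le_trans cr0).
rewrite lnM ?posrE// ln_powR.
have : ln r <= ln c / e by rewrite -[leRHS]expRK ler_ln ?posrE ?expR_gt0.
rewrite ler_pdivlMr//; lra.
Qed.

(** * From the Borel transform hypothesis to a bound for each admissible [gam] *)

Lemma borel_transform_lower (R : realType)
    (mu : {finite_measure set (measurableTypeR R) -> \bar R}) (x m s : R) :
    (0 < limf_einf
       (fun eps : R => (eps `^ (- s))%:E * borel_transform mu m x eps)
       0^'+)%E ->
  exists2 c, 0 < c & exists2 d, 0 < d & forall a, 0 < a <= d ->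
    c * a `^ s <=
    a `^ m * fine (\int[mu]_y ((`|x - y| `^ m + a `^ m)^-1)%:E)%E.
Proof.
set l := limf_einf _ _ => l0.
(* The lower limit may be infinite, hence a real constant strictly below it. *)
have [c c0 cl] : exists2 c : R, 0 < c & (c%:E < l)%E.
  case: l l0 => [l| |]//; last by exists 1; rewrite ?ltry.
  rewrite lte_fin => l0; exists (l / 2); rewrite ?lte_fin; lra.
have [d d0 dJ] := (near_at_right0P _ _).1 (lt_limf_einf_near _ _ _ _ _ _ _ cl).
exists c => //; exists d => // a /andP[a0 ad].
have := dJ a; rewrite a0 ad => /(_ erefl) /=.
rewrite /borel_transform -kernel_integral_fineK// -!EFinM lte_fin.
rewrite powRN ltr_pdivlMl ?powR_gt0// mulrC; exact: ltW.
Qed.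

Lemma upper_exponent_le_of_lt (R : realType)
    (mu : {finite_measure set (measurableTypeR R) -> \bar R})
    (x m s gam : R) :
    msupport mu x -> 0 <= s -> s < m ->
    (0 < limf_einf
       (fun eps : R => (eps `^ (- s))%:E * borel_transform mu m x eps)
       0^'+)%E ->
    gam < m -> (gam%:E < lower_exponent mu x)%E ->
  (upper_exponent mu x <= (s * (m - gam) / (m - s))%:E)%E.
Proof.
move=> xS s0 sm J gm glow.
have m0 : 0 < m by lra.
pose f r := fine (mu `[(x - r)%R, (x + r)%R]%classic).
pose g a := fine (\int[mu]_y ((`|x - y| `^ m + a `^ m)^-1)%:E)%E.
have fE r : (f r)%:E = mu `[(x - r)%R, (x + r)%R]%classic.
  by rewrite fineK// fin_num_measure//; exact: measurable_itv.
have gE a : 0 < a ->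
    ((g a)%:E = \int[mu]_y ((`|x - y| `^ m + a `^ m)^-1)%:E)%E.
  exact: kernel_integral_fineK.
have gsplit a r : 0 < a -> 0 < r -> g a <= a `^ (- m) * f r + 2 * g r.
  move=> a0 r0; rewrite -lee_fin EFinD !EFinM fE !gE//.
  exact: kernel_integral_split.
have gM r : 0 < r -> g r <= r `^ (- m) * fine (mu setT).
  move=> r0; rewrite -lee_fin EFinM gE// fineK ?fin_num_measure//.
  exact: kernel_integral_le.
(* Near 0 the log ratio exceeds [gam]; multiplying by [ln r], negative for [r <= 1/2], gives the
   power bound. *)
have [d1 d10 fgam] : exists2 d, 0 < d & forall r, 0 < r <= d -> f r <= r `^ gam.
  have [d d0 dP] :=
    (near_at_right0P _ _).1 (lt_limf_einf_near _ _ _ _ _ _ _ glow).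
  exists (Num.min d 2^-1); first by rewrite lt_min d0 invr_gt0 ltr0n.
  move=> r /andP[r0]; rewrite le_min => /andP[rd r2].
  have := dP r; rewrite r0 rd => /(_ erefl) /=.
  have lnr : ln r < 0 by rewrite ln_lt0// r0/=; lra.
  rewrite log_ratioE// lte_fin ltr_ndivlMr// -ln_powR => /ltW.
  by rewrite ler_ln ?posrE ?powR_gt0// -lte_fin fE ball_mass_gt0.
have [c c0 [d2 d20 glow2]] := borel_transform_lower _ _ _ _ _ J.
have M0 : 0 <= fine (mu setT) by rewrite fine_ge0.
have [C C0 gC] := scale_induction _ g f m gam d1 _ gm m0 d10 M0 gsplit gM fgam.
pose d := Num.min d1 d2.
have dle r : 0 < r <= d -> (0 < r <= d1) && (0 < r <= d2).
  by rewrite /d le_min => /and3P[-> -> ->].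
have d0 : 0 < d by rewrite lt_min d10.
have [||c' c'0 [eta eta0 cf]] :=
  lower_power_bound _ g f m gam s d c C gm sm d0 c0 C0 gsplit.
- by move=> r /dle/andP[h _]; exact: gC.
- by move=> r /dle/andP[_ h]; exact: glow2.
exact: upper_exponent_le cf.
Qed.

(** * Passage to the limit as [gam] increases to the lower exponent *)

Theorem theorem1p3 (R : realType)
    (mu : {finite_measure set (measurableTypeR R) -> \bar R})
    (x m s : R)
    (mu_atomless : atomless mu)
    (x_supp : msupport mu x)
    (s_ge0 : 0 <= s)
    (s_lt_m : s < m)
    (J_liminf : (0 < limf_einf
       (fun eps : R => (eps `^ (- s))%:E * borel_transform mu m x eps)
       0^'+)%E) :
  (upper_exponent mu x <=
     s%:E * (m%:E - lower_exponent mu x) * ((m - s)^-1)%:E)%E /\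
  (upper_exponent mu x <= (m * s / (m - s))%:E)%E.
Proof.
have ms0 : 0 < m - s by rewrite subr_gt0.
have m0 : 0 < m by lra.
set up := upper_exponent mu x; set low := lower_exponent mu x.
have upP (gam : R) : gam < m -> (gam%:E < low)%E ->
    (up <= (s * (m - gam) / (m - s))%:E)%E.
  exact: upper_exponent_le_of_lt.
have low0 : (0 <= low)%E := lower_exponent_ge0 _ _ _ x_supp.
have lowup : (low <= up)%E by exact: limf_einf_le_esup.
(* Otherwise every [gam < m] is admissible, and [gam] tending to [m] forces [up <= 0], against
   [0 < m <= low <= up]. *)
have lowm : (low < m%:E)%E.
  rewrite ltNge; apply/negP => mlow.
  suff : (up <= 0)%E.
    move=> up0; have := le_trans mlow (le_trans lowup up0).
    by rewrite lee_fin leNgt m0.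
  apply/lee_addgt0Pr => e e0; rewrite add0e.
  (* Moving [gam] by [t] changes the bound by [e * s / (s + 1) <= e]; the denominator [s + 1] also
     covers [s = 0]. *)
  pose t := e * (m - s) / (s + 1).
  have t0 : 0 < t by rewrite divr_gt0 ?mulr_gt0//; lra.
  have mt : m - t < m by lra.
  apply: (le_trans (upP _ mt _)).
    by rewrite (lt_le_trans _ mlow) ?lte_fin.
  rewrite lee_fin ler_pdivrMr// /t.
  have -> : s * (m - (m - e * (m - s) / (s + 1))) =
      e * (m - s) * (s / (s + 1)) by field; lra.
  rewrite ler_piMr ?mulr_ge0 ?(ltW e0) ?(ltW ms0)// ler_pdivrMr; lra.
(* Being between 0 and [m], the lower exponent is real, so the extended-real formula reduces to real
   arithmetic. *)
have [l lE] : exists l : R, low = l%:E.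
  by move: low0 lowm; case: (low) => // l; exists l.
rewrite lE in upP low0 lowm *.
move: low0 lowm; rewrite lee_fin lte_fin => l0 lm.
have main : (up <= (s * (m - l) / (m - s))%:E)%E.
  apply/lee_addgt0Pr => e e0.
  pose t := e * (m - s) / (s + 1).
  have t0 : 0 < t by rewrite divr_gt0 ?mulr_gt0//; lra.
  apply: (le_trans (upP (l - t) _ _)); rewrite ?lte_fin; [lra..|].
  rewrite -EFinD lee_fin.
  have -> : s * (m - (l - t)) / (m - s) =
     s * (m - l) / (m - s) + e * (s / (s + 1)).
    by rewrite /t; field; apply/andP; split; lra.
  by rewrite lerD2l ler_piMr ?(ltW e0)// ler_pdivrMr; lra.
split; first by rewrite -EFinB -!EFinM.
apply: (le_trans main).
(* Since [l] is nonnegative, [m - l <= m]. *)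
by rewrite lee_fin ler_pM2r ?invr_gt0// mulrC ler_wpM2r//; lra.
Qed.
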